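(* Let $K\subseteq\mathbb{R}^n$ be nonempty, closed and convex, let $H,Q:\mathbb{R}^n\to\mathbb{R}^n$ be continuous, and let $\eta>0$. Let $R_\eta(x)=H(x)-P_K(H(x)-\eta Q(x))$ and assume that $X^*=\{x\in\mathbb{R}^n:R_\eta(x)=0\}$ is nonempty and closed. Suppose that: (1) there is $L_R>0$ such that $\|R_\eta(x)-R_\eta(y)\|\le L_R\|x-y\|$ for all $x,y\in\mathbb{R}^n$ (for example, one may take $L_R=2L_H+\eta L_Q$ when $H$ and $Q$ are Lipschitz continuous with constants $L_H>0$ and $L_Q>0$); (2) there is $\mu>0$ such that, for every $x\in\mathbb{R}^n$ and every $\bar x\in P_{X^*}(x)$, $\langle R_\eta(x),x-\bar x\rangle\ge \mu\operatorname{dist}(x,X^* )^2$. Let $\alpha\in(0,2\mu/L_R^2)$, let $x_0\in\mathbb{R}^n$ be arbitrary, and let $x_{k+1}=x_k-\alpha R_\eta(x_k)$ for $k=0,1,2,\dots$. Then, for every $k\ge 0$, $$\operatorname{dist}(x_{k+1},X^* )^2\le \rho\,\operatorname{dist}(x_k,X^* )^2,\qquad \rho:=1-2\alpha\mu+\alpha^2L_R^2 .$$ Moreover, $\rho<1$; and if $X^*\ne\mathbb{R}^n$, then $\rho\in[0,1)$. In particular, choosing $\alpha=\mu/L_R^2$ gives $\operatorname{dist}(x_{k+1},X^* )^2\le (1-\mu^2/L_R^2)\operatorname{dist}(x_k,X^* )^2$ for every $k\ge 0$.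
   Context: $\langle\cdot,\cdot\rangle$ and $\|\cdot\|$ are the Euclidean inner product and norm on $\mathbb{R}^n$. $P_K$ is the Euclidean projection onto $K$. For the nonempty closed set $X^*$ (not assumed convex), $\operatorname{dist}(x,X^* )=\min_{y\in X^*}\|x-y\|$, and $P_{X^*}(x)=\{\bar x\in X^*:\|x-\bar x\|=\operatorname{dist}(x,X^* )\}$ is the set of all nearest points of $X^*$ to $x$. (The zeros of $R_\eta$ are the solutions of the general variational inequality: find $x^*$ with $H(x^* )\in K$ and $\langle y-H(x^* ),Q(x^* )\rangle\ge 0$ for all $y\in K$.) *)

(* Defs.v *)
From HB Require Import structures.
From mathcomp Require Export all_boot all_order all_algebra.
From mathcomp Require Export all_classical all_reals all_analysis.
Export Order.TTheory GRing.Theory Num.Theory numFieldNormedType.Exports.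

Set Implicit Arguments.
Unset Strict Implicit.
Unset Printing Implicit Defensive.

Local Open Scope classical_set_scope.
Local Open Scope ring_scope.

(* Vectors of R^n are row vectors.  The library norm on ['rV[R]_n] is the sup
   norm, hence the Euclidean norm is defined separately; [continuous] and
   [closed] refer to the library (product) topology, which is the Euclidean
   one. *)
Section Euclidean.
Context {R : realType} {n : nat}.
Implicit Types (x y : 'rV[R]_n) (S : set 'rV[R]_n).

Definition dotv x y : R := \sum_(i < n) x 0 i * y 0 i.

Definition enorm x : R := Num.sqrt (dotv x x).

(* Meaningful for nonempty [S]; the infimum is attained when [S] is moreover
   closed. *)
Definition dist x S : R := inf [set enorm (x - y) | y in S].

Definition nearest S x : set 'rV[R]_n :=
  [set y | S y /\ enorm (x - y) = dist x S].

(* When [K] is nonempty, closed and convex, [nearest K x] is a singleton; the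
   default value [0] is irrelevant. *)
Definition proj (K : set 'rV[R]_n) x : 'rV[R]_n := xget 0 (nearest K x).

Definition elipschitz (L : R) (F : 'rV[R]_n -> 'rV[R]_n) : Prop :=
  forall x y, enorm (F x - F y) <= L * enorm (x - y).

Definition residual (K : set 'rV[R]_n) (H Q : 'rV[R]_n -> 'rV[R]_n) (eta : R)
    x : 'rV[R]_n :=
  H x - proj K (H x - eta *: Q x).

Definition residual_zeros (K : set 'rV[R]_n) (H Q : 'rV[R]_n -> 'rV[R]_n)
    (eta : R) : set 'rV[R]_n :=
  [set x | residual K H Q eta x = 0].

End Euclidean.

(* Main.v *)
Require Import Defs.
From mathcomp Require Import ring lra.

Local Open Scope classical_set_scope.
Local Open Scope ring_scope.

(** The contraction only uses a nearest point [p] of [Xstar] to the current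
    iterate [x].  As [p] stays in [Xstar], it is a competitor for the distance
    of the next iterate [x - alpha *: Reta x], and expanding the square,
    [|x - alpha *: Reta x - p|^2
       = |x - p|^2 - 2 alpha <Reta x, x - p> + alpha^2 |Reta x|^2].
    The growth condition bounds the inner product below by [mu * |x - p|^2];
    since [Reta p = 0], the Lipschitz condition bounds [|Reta x|] by
    [L_R * |x - p|].  The sum is at most [rho * |x - p|^2]
    ([gradient_step_contraction]).

    The existence of [p] is where closedness of [Xstar] and finite dimension
    enter ([nearest_exists]).  It also gives [0 <= rho]: a point outside
    [Xstar] is at positive distance, so a negative [rho] would make the squared
    distance after one step negative.

    For the explicit Lipschitz constant, closedness and convexity of [K] give
    the variational inequality of the projection ([nearest_convex_obtuse]),
    hence its nonexpansiveness ([proj_nonexpansive]); the triangle inequality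
    then counts [L_H] once for [H x] and [L_H + eta * L_Q] once for the
    projected point. *)

(** * Euclidean inner product and norm *)

Section EuclideanTheory.
Set Implicit Arguments.
Unset Strict Implicit.
Context {R : realType} {n : nat}.
Implicit Types (x y z u v : 'rV[R]_n) (S K : set 'rV[R]_n).

Lemma dotvC x y : dotv x y = dotv y x.
Proof. by apply: eq_bigr => i _; rewrite mulrC. Qed.

Lemma dotvDl x y z : dotv (x + y) z = dotv x z + dotv y z.
Proof. by rewrite -big_split; apply: eq_bigr => i _; rewrite mxE mulrDl. Qed.

Lemma dotvZl (a : R) x y : dotv (a *: x) y = a * dotv x y.
Proof. by rewrite /dotv mulr_sumr; apply: eq_bigr => i _; rewrite mxE mulrA. Qed.

Lemma dotvNl x y : dotv (- x) y = - dotv x y.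
Proof. by rewrite -scaleN1r dotvZl mulN1r. Qed.

Lemma dotvBl x y z : dotv (x - y) z = dotv x z - dotv y z.
Proof. by rewrite dotvDl dotvNl. Qed.

Lemma dotv_ge0 x : 0 <= dotv x x.
Proof. by apply: sumr_ge0 => i _; exact: sqr_ge0. Qed.

Lemma dotv_eq0 x : dotv x x = 0 -> x = 0.
Proof.
move=> /eqP; rewrite psumr_eq0 => [/allP x0|i _]; last exact: sqr_ge0.
apply/rowP => i; rewrite mxE; apply/eqP.
by have := x0 i (mem_index_enum i); rewrite mulf_eq0 orbb.
Qed.

Lemma enorm_ge0 x : 0 <= enorm x.
Proof. exact: sqrtr_ge0. Qed.

Lemma enorm_sqr x : enorm x ^+ 2 = dotv x x.
Proof. by rewrite sqr_sqrtr ?dotv_ge0. Qed.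

Lemma enorm_eq0 x : enorm x = 0 -> x = 0.
Proof. by move=> x0; apply: dotv_eq0; rewrite -enorm_sqr x0 expr0n. Qed.

Lemma enormZ (a : R) x : enorm (a *: x) = `|a| * enorm x.
Proof.
by rewrite /enorm dotvZl dotvC dotvZl mulrA -expr2 sqrtrM ?sqr_ge0// sqrtr_sqr.
Qed.

Lemma enormN x : enorm (- x) = enorm x.
Proof. by rewrite -scaleN1r enormZ normrN1 mul1r. Qed.

Lemma enorm_sqrB x y :
  enorm (x - y) ^+ 2 = enorm x ^+ 2 - 2 * dotv x y + enorm y ^+ 2.
Proof.
rewrite !enorm_sqr dotvBl dotvC dotvBl (dotvC y (x - y)) dotvBl (dotvC y x).
ring.
Qed.

Lemma dotv_le_enorm x y : dotv x y <= enorm x * enorm y.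
Proof.
have [x0|nx] := eqVneq (enorm x) 0.
  by rewrite x0 mul0r (enorm_eq0 x0) -(scale0r 0) dotvZl mul0r.
have [y0|ny] := eqVneq (enorm y) 0.
  by rewrite y0 mulr0 (enorm_eq0 y0) dotvC -(scale0r 0) dotvZl mul0r.
have xy0 : 0 < enorm x * enorm y by rewrite mulr_gt0// lt0r ?nx ?ny enorm_ge0.
(* Both vectors are rescaled to the common norm [enorm x * enorm y]. *)
have := sqr_ge0 (enorm (enorm y *: x - enorm x *: y)).
rewrite enorm_sqrB !enormZ !ger0_norm ?enorm_ge0//.
rewrite dotvZl dotvC dotvZl dotvC => h.
rewrite -(ler_pM2l xy0); nra.
Qed.

Lemma enorm_triangle x y : enorm (x + y) <= enorm x + enorm y.
Proof.
rewrite -(@ler_pXn2r _ 2)// ?nnegrE ?addr_ge0 ?enorm_ge0//.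
rewrite -[y in enorm (x + y)]opprK enorm_sqrB enormN dotvC dotvNl dotvC.
have := dotv_le_enorm x y; nra.
Qed.

Lemma coord_le_enorm x i : `|x 0 i| <= enorm x.
Proof.
rewrite -sqrtr_sqr ler_wsqrtr// /dotv (bigD1 i)//= -expr2 lerDl.
by apply: sumr_ge0 => j _; exact: sqr_ge0.
Qed.

Lemma enorm_sub_continuous x : continuous (fun y => enorm (x - y)).
Proof.
have cf : continuous (fun y => dotv (x - y) (x - y)).
  apply: (@continuous_big _ _ +%R) => [|i _ y]; first exact: add_continuous.
  have ci : continuous (fun y : 'rV[R]_n => (x - y) 0 i).
    rewrite (_ : (fun _ => _) = (fun y => x 0 i - y 0 i)).
      move=> v; apply: continuousB; [exact: cst_continuous|exact: coord_continuous].
    by apply/funext => v; rewrite !mxE.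
  by apply: continuousM; exact: ci.
by move=> y; apply: (continuous_comp (cf y)); exact: sqrt_continuous.
Qed.

(** * Nearest points and projection *)

Lemma dist_le S x y : S y -> dist x S <= enorm (x - y).
Proof.
move=> Sy; apply: ge_inf; last by exists y.
by exists 0 => _ [z _ <-]; exact: enorm_ge0.
Qed.

Lemma nearest_minimizer S x y : S y ->
  (forall z, S z -> enorm (x - y) <= enorm (x - z)) -> nearest S x y.
Proof.
move=> Sy ymin; split => //; apply/le_anti; rewrite dist_le// andbT.
apply: lb_le_inf => [|_ [z Sz <-]]; last exact: ymin.
by exists (enorm (x - y)), y.
Qed.

Lemma dist_ge0 S x : S !=set0 -> 0 <= dist x S.
Proof.
move=> [y Sy]; apply: lb_le_inf => [|_ [z _ <-]]; last exact: enorm_ge0.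
by exists (enorm (x - y)), y.
Qed.

(** Only the part of [S] in a cube around [x] competes for the minimum: a point
    outside the cube is farther from [x] than the point [s] that fixes the
    size of the cube. *)
Lemma nearest_exists S x : S !=set0 -> closed S -> nearest S x !=set0.
Proof.
move=> [s Ss] clS; set M := enorm (x - s).
pose cube : set 'rV[R]_n :=
  [set v | forall i, `[x 0 i - M, x 0 i + M]%classic (v ord0 i)].
have ccube : compact cube.
  apply: (@rV_compact _ _ (fun i => `[x 0 i - M, x 0 i + M]%classic)) => i.
  exact: (@segment_compact R).
have cubeP v : enorm (x - v) <= M -> cube v.
  move=> vM i; have := le_trans (coord_le_enorm (x - v) i) vM.
  by rewrite /= in_itv/= ler_norml !mxE => /andP[? ?]; apply/andP; split; lra.
have cSc : compact (S `&` cube).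
  by rewrite setIC; exact: (compact_closedI ccube clS).
have [||y /set_mem[Sy _] ymin] := @EVT_min_rV _ _ (fun y => enorm (x - y)) _ _ cSc.
- by exists s; split => //; exact: cubeP.
- exact/continuous_subspaceT/enorm_sub_continuous.
exists y; apply: nearest_minimizer => // z Sz.
have [zM|/ltW Mz] := leP (enorm (x - z)) M.
  by apply: ymin; rewrite inE; split => //; exact: cubeP.
by apply: le_trans Mz; apply: ymin; rewrite inE; split => //; exact: cubeP.
Qed.

(** Moving from [y] to [y + t (z - y)] inside [K] cannot decrease the distance
    to [x]; to first order in [t] this is the claim. *)
Lemma nearest_convex_obtuse K x y z : convex_set K ->
  nearest K x y -> K z -> dotv (x - y) (z - y) <= 0.
Proof.
move=> cK [Ky xy] Kz; rewrite leNgt; apply/negP => a0.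
set a := dotv _ _ in a0; pose b := enorm (z - y) ^+ 2.
have b0 : 0 <= b := sqr_ge0 _.
have ab0 : 0 < a + b by rewrite ltr_wpDr.
(* For this [t] the squared distance changes by
   [- 2 a t + b t ^ 2 = - a t (2 a + b) / (a + b) < 0]. *)
pose t := a / (a + b).
have t0 : 0 < t by rewrite divr_gt0.
have tab : t * (a + b) = a by rewrite mulfVK// gt_eqF.
have t1 : t <= 1 by rewrite ler_pdivrMr// mul1r lerDl.
have Kw : K (y + t *: (z - y)).
  have -> : y + t *: (z - y) = t *: z + (1 - t) *: y.
    by rewrite scalerBl scale1r scalerBr addrCA.
  exact/set_mem/(cK z y (Itv01 (ltW t0) t1) (mem_set Kz) (mem_set Ky)).
have := dist_le x Kw; rewrite -xy opprD addrA.
rewrite -(@ler_pXn2r _ 2)// ?nnegrE ?enorm_ge0//.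
rewrite [leRHS]enorm_sqrB dotvC dotvZl dotvC -/a enormZ exprMn -/b gtr0_norm//.
have ta0 := mulr_gt0 t0 a0; have tta0 := mulr_gt0 t0 ta0.
have ttb : t ^+ 2 * b = t * a - t * (t * a) by rewrite -mulrBr -{1}tab; ring.
lra.
Qed.

Lemma proj_nearest K x : K !=set0 -> closed K -> nearest K x (proj K x).
Proof. by move=> K0 clK; apply: xgetPex; exact: nearest_exists. Qed.

(** With [d = p - q] the difference of the projections, adding the variational
    inequality at [p] tested against [q] to the one at [q] tested against [p]
    gives [|d|^2 <= <u - v, d>]; expanding [0 <= |u - v - d|^2] then bounds
    [|d|] by [|u - v|]. *)
Lemma proj_nonexpansive K : K !=set0 -> closed K -> convex_set K ->
  elipschitz 1 (proj K).
Proof.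
move=> K0 clK cK u v; have nu := proj_nearest u K0 clK.
have nv := proj_nearest v K0 clK; rewrite mul1r.
have := nearest_convex_obtuse cK nu nv.1.
have := nearest_convex_obtuse cK nv nu.1.
move: (proj K u) (proj K v) => p q; set d := p - q.
rewrite -[q - p]opprB -/d dotvC => h1; rewrite dotvC dotvNl => h2.
have h : enorm d ^+ 2 <= dotv (u - v) d.
  have -> : u - v = (u - p) - (v - q) + d by rewrite /d; apply/rowP => i; rewrite !mxE; ring.
  rewrite dotvDl dotvBl -enorm_sqr.
  by rewrite (dotvC (u - p)) (dotvC (v - q)); lra.
rewrite -(@ler_pXn2r _ 2)// ?nnegrE ?enorm_ge0//.
have := sqr_ge0 (enorm (u - v - d)); rewrite enorm_sqrB; lra.
Qed.

Lemma residual_lipschitz K (H Q : 'rV[R]_n -> 'rV[R]_n) (eta L_H L_Q : R) :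
  K !=set0 -> closed K -> convex_set K -> 0 <= eta ->
  elipschitz L_H H -> elipschitz L_Q Q ->
  elipschitz (2 * L_H + eta * L_Q) (residual K H Q eta).
Proof.
move=> K0 clK cK eta0 lipH lipQ x y; rewrite /residual.
set p := proj K _; set q := proj K _.
have -> : H x - p - (H y - q) = (H x - H y) + - (p - q).
  by apply/rowP => i; rewrite !mxE; ring.
apply: (le_trans (enorm_triangle _ _)); rewrite enormN.
have := proj_nonexpansive K0 clK cK (H x - eta *: Q x) (H y - eta *: Q y).
rewrite -/p -/q mul1r.
have -> : H x - eta *: Q x - (H y - eta *: Q y) =
          (H x - H y) + - (eta *: (Q x - Q y)).
  by apply/rowP => i; rewrite !mxE; ring.
have := enorm_triangle (H x - H y) (- (eta *: (Q x - Q y))).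
rewrite enormN enormZ ger0_norm//.
have := lipH x y; have := ler_wpM2l eta0 (lipQ x y); lra.
Qed.

(** * Contraction of the distance *)

Lemma gradient_step_contraction S (F : 'rV[R]_n -> 'rV[R]_n)
    (L mu alpha : R) x :
  S !=set0 -> closed S -> (forall s, S s -> F s = 0) -> elipschitz L F ->
  (forall p, nearest S x p -> mu * dist x S ^+ 2 <= dotv (F x) (x - p)) ->
  0 <= alpha ->
  dist (x - alpha *: F x) S ^+ 2 <=
    (1 - 2 * alpha * mu + alpha ^+ 2 * L ^+ 2) * dist x S ^+ 2.
Proof.
move=> S0 clS F0 lipF growth alpha0.
have [p np] := nearest_exists x S0 clS.
have [Sp xp] := np.
have Fx : enorm (F x) ^+ 2 <= L ^+ 2 * dist x S ^+ 2.
  have := lipF x p; rewrite (F0 p Sp) subr0 xp => Fx.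
  rewrite -exprMn ler_pXn2r// ?nnegrE ?enorm_ge0//.
  exact: le_trans (enorm_ge0 _) Fx.
have step : dist (x - alpha *: F x) S ^+ 2 <= enorm (x - p - alpha *: F x) ^+ 2.
  rewrite ler_pXn2r// ?nnegrE ?enorm_ge0 ?dist_ge0//.
  by rewrite addrAC; exact: dist_le.
apply: (le_trans step); rewrite enorm_sqrB xp dotvC dotvZl enormZ exprMn.
rewrite ger0_norm//.
have := ler_wpM2l alpha0 (growth p np).
have := ler_wpM2l (sqr_ge0 alpha) Fx; lra.
Qed.

Lemma dist_gt0 S x : S !=set0 -> closed S -> ~ S x -> 0 < dist x S.
Proof.
move=> S0 clS nSx; rewrite lt0r dist_ge0// andbT; apply/eqP => d0.
have [p [Sp xp]] := nearest_exists x S0 clS.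
by apply: nSx; rewrite (subr0_eq (enorm_eq0 (etrans xp d0))).
Qed.

End EuclideanTheory.

Theorem theorem4p2 (R : realType) (n : nat) (K : set 'rV[R]_n)
  (H Q : 'rV[R]_n -> 'rV[R]_n) (eta : R)
  (K_nonempty : K !=set0) (K_closed : closed K)
  (K_convex : convex_set K)
  (H_continuous : continuous H) (Q_continuous : continuous Q)
  (eta_gt0 : 0 < eta)
  (Xstar_nonempty : residual_zeros K H Q eta !=set0)
  (Xstar_closed : closed (residual_zeros K H Q eta)) :
  let Reta := residual K H Q eta in
  let Xstar := residual_zeros K H Q eta in
  (forall L_H L_Q : R, 0 < L_H -> 0 < L_Q ->
     elipschitz L_H H -> elipschitz L_Q Q ->
     elipschitz (2 * L_H + eta * L_Q) Reta) /\
  (forall L_R mu : R,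
     0 < L_R -> elipschitz L_R Reta ->
     0 < mu ->
     (forall x xbar : 'rV[R]_n, nearest Xstar x xbar ->
        dotv (Reta x) (x - xbar) >= mu * dist x Xstar ^+ 2) ->
     (forall (alpha : R) (x0 : 'rV[R]_n) (x : nat -> 'rV[R]_n),
        0 < alpha -> alpha < 2 * mu / L_R ^+ 2 ->
        x 0%N = x0 ->
        (forall k : nat, x k.+1 = x k - alpha *: Reta (x k)) ->
        let rho := 1 - 2 * alpha * mu + alpha ^+ 2 * L_R ^+ 2 in
        [/\ forall k : nat,
              dist (x k.+1) Xstar ^+ 2 <= rho * dist (x k) Xstar ^+ 2,
            rho < 1 &
            Xstar <> setT -> 0 <= rho /\ rho < 1]) /\
     (forall (x0 : 'rV[R]_n) (x : nat -> 'rV[R]_n),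
        x 0%N = x0 ->
        (forall k : nat, x k.+1 = x k - (mu / L_R ^+ 2) *: Reta (x k)) ->
        forall k : nat,
          dist (x k.+1) Xstar ^+ 2
            <= (1 - mu ^+ 2 / L_R ^+ 2) * dist (x k) Xstar ^+ 2)).
Proof.
move=> Reta Xstar; split=> [L_H L_Q _ _ lipH lipQ|L_R mu L_R0 lipR mu0 growth].
  exact: residual_lipschitz (ltW eta_gt0) lipH lipQ.
have step alpha y : 0 <= alpha -> dist (y - alpha *: Reta y) Xstar ^+ 2 <=
    (1 - 2 * alpha * mu + alpha ^+ 2 * L_R ^+ 2) * dist y Xstar ^+ 2.
  by apply: gradient_step_contraction => // p; exact: growth.
have L2 : 0 < L_R ^+ 2 by rewrite exprn_gt0.
split=> [alpha x0 x alpha0 alpha_lt _ xS rho|x0 x _ xS k].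
  have rho_lt1 : rho < 1.
    move: alpha_lt; rewrite ltr_pdivlMr// => alpha_lt.
    by rewrite /rho; nra.
  split=> // [k|XsT]; first by rewrite xS; exact: step (ltW alpha0).
  split=> //.
  have [y nXy] : exists y, ~ Xstar y.
    by apply/existsNP => XT; apply: XsT; apply/seteqP; split.
  have d2 : 0 < dist y Xstar ^+ 2 by rewrite exprn_gt0// dist_gt0.
  rewrite -(pmulr_lge0 _ d2).
  exact: le_trans (sqr_ge0 _) (step alpha y (ltW alpha0)).
have alpha0 : 0 <= mu / L_R ^+ 2 by rewrite divr_ge0// ltW.
rewrite xS; apply: (le_trans (step _ _ alpha0)).
suff -> : 1 - 2 * (mu / L_R ^+ 2) * mu + (mu / L_R ^+ 2) ^+ 2 * L_R ^+ 2 =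
          1 - mu ^+ 2 / L_R ^+ 2 by [].
by field; rewrite gt_eqF.
Qed.
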